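(* For every $\beta > 0$ and $\delta > 0$ there exists $C > 0$ (depending only on $\beta$ and $\delta$) such that the following holds for every positive integer $n$. If $B \subseteq \{\pm 1\}^n$ is of size $|B| = 2^{\beta n}$ and $Y$ is uniformly distributed in $B$, then for all but at most $2^{n(1-\beta+\delta)}$ directions $x \in \{\pm 1\}^n$, $$\max_{k \in \mathbb{Z}} \Pr_Y[\langle x, Y\rangle = k] \leq \frac{C}{\sqrt{n}}.$$
   Context: $\langle x, y\rangle = \sum_{j=1}^n x_j y_j$ is the standard inner product, computed over the integers. *)

(* Defs.v *)
From HB Require Import structures.
From mathcomp Require Import all_boot all_order all_algebra.
From mathcomp Require Import all_classical all_reals all_analysis.
Set Implicit Arguments.
Unset Strict Implicit.
Unset Printing Implicit Defensive.
Import Order.TTheory GRing.Theory Num.Theory.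
Local Open Scope ring_scope.

Notation pm1 := (seq_sub [:: 1; -1 : int]).

Notation cube n := {ffun 'I_n -> pm1}.

Definition inner (n : nat) (x y : cube n) : int :=
  \sum_(j < n) ssval (x j) * ssval (y j).

(* The probability of the event E under the uniform distribution on B; only
   meaningful for B nonempty (for B empty it is 0, since 0^-1 = 0). *)
Definition unif_prob (R : realType) (T : finType) (B : {set T}) (E : pred T) : R :=
  #|[set y in B | E y]|%:R / #|B|%:R.

(* The supremum over all integers k; it is attained, see max_inner_probP. *)
Definition max_inner_prob (R : realType) (n : nat) (B : {set cube n})
    (x : cube n) : R :=
  sup (range (fun k : int => unif_prob R B (fun y => inner x y == k))).

Lemma max_inner_probP (R : realType) (n : nat) (B : {set cube n}) (x : cube n) :
  let p k := unif_prob R B (fun y => inner x y == k) in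
  (exists k, p k = max_inner_prob R B x) /\
  (forall k, p k <= max_inner_prob R B x).
Proof.
move=> p.
have p_ge0 k : 0 <= p k by rewrite divr_ge0 ?ler0n.
have [k0 pk0] : exists k0, forall k, p k <= p k0.
  case: (@arg_maxP _ R (cube n) x xpredT (fun y => p (inner x y)) isT) => y0 _ y0P.
  exists (inner x y0) => k.
  have [E0|[y]] := set_0Vmem [set y in B | inner x y == k].
    by rewrite {1}/p /unif_prob E0 cards0 mul0r.
  by rewrite inE => /andP[_ /eqP <-]; apply: y0P.
have supE : max_inner_prob R B x = p k0.
  apply/eqP; rewrite eq_le; apply/andP; split.
    by apply: ge_sup => [|_ [k _ <-]]; [exists (p k0), k0|exact: pk0].
  by apply: ub_le_sup; [exists (p k0) => _ [k _ <-]; exact: pk0|exists k0].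
by split=> [|k]; [exists k0; rewrite supE|rewrite supE].
Qed.

(* Main.v *)
Require Import Defs.
From mathcomp Require Import all_boot all_order all_algebra.
From mathcomp Require Import all_classical all_reals all_analysis.
From mathcomp Require Import ring lra zify.
Import Order.TTheory GRing.Theory Num.Theory.
Import numFieldNormedType.Exports.
Set Implicit Arguments.
Unset Strict Implicit.
Unset Printing Implicit Defensive.
Local Open Scope ring_scope.

(** Write [d] for the Hamming distance on the cube, so that
    [<x, Y> = n - 2 d(x, Y)], and put [phi_a(x) = E_Y exp(i a d(x, Y))].
    Since [d] takes values in [0, n], Fourier inversion modulo [2(n+1)] bounds
    every point probability of [<x, Y>] by the average of [|phi_a(x)|] over the
    frequencies [a = pi t / (n+1)], [t < 2(n+1)] ([point_prob_le]).

    The heart of the proof is a moment bound over the whole cube of directions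
    ([fourier_moment_le]): for an even exponent [q] of order
    [1 / (eps^4 (1 - |cos a|))],
        [sum_x |phi_a(x)|^q <= (2 (1 + 8 eps))^n / |B|].
    For [a = pi/2] one could take [q = 2], by Parseval; as [a] approaches a
    multiple of [pi] the exponent grows, but the right-hand side does not.  It is
    a hypercontractive estimate for the matrix [exp(i a d(x, y))], which is a
    tensor power, so an induction on [n] reduces it to an inequality about two
    complex numbers [u], [v] and weights [lam + mu = 1]
    ([two_point_rotation]), with [w = exp(i a)]:
        [|lam u + mu w v|^q + |lam w u + mu v|^q
           <= 2 (1 + 8 eps) (lam^2 |u|^q + mu^2 |v|^q)].
    Here [lam] and [mu] are the proportions of [B] in the two halves of the cube,
    and the squares are what makes the powers of [|B|] add up.  The inequality
    holds because either one of the two summands dominates, and then it alone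
    pays for both terms on the left; or they are balanced, and then [w] prevents
    both numbers on the left from being close to [h = lam |u| + mu |v|]: the
    larger one satisfies [h^q <= 2 (lam^2 |u|^q + mu^2 |v|^q)] by convexity and
    Cauchy-Schwarz, and the [q]-th power of the smaller one is negligible.

    Now let [A] be the set of bad directions and suppose [|A| |B|] exceeds
    [2^((1 + delta) n)].  With [eps] small in terms of [delta], the moment bound
    makes the average of [|phi_a|] over [A] at most
    [2 / (1 + c n (1 - |cos a|))] ([sum_fourier_abs_le]).  As [1 - |cos a|] is
    quadratic in the distance from [a] to the multiples of [pi], the sum of these
    bounds over the [2(n+1)] frequencies is [O(sqrt n)] ([sum_decay_le]).  Hence
    the average over [A] of the maximal point probability is at most
    [C / sqrt n], although each term exceeds it. *)

(** * Power means of two numbers *)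

Section TwoPoint.
Variable R : realFieldType.
Implicit Types (lam mu sig tau eps eta kap x y : R) (m l : nat).

Lemma bernoulli x m : -1 <= x -> 1 + m%:R * x <= (1 + x) ^+ m.
Proof.
move=> x1; elim: m => [|m IH]; first by rewrite mul0r addr0 expr0.
have x0 : 0 <= 1 + x by lra.
rewrite exprSr (le_trans _ (ler_wpM2r x0 IH))// -(natr1 m).
have := mulr_ge0 (ler0n R m) (sqr_ge0 x); lra.
Qed.

Lemma exprn_convex lam mu sig tau m : 0 <= lam -> 0 <= mu -> lam + mu = 1 ->
  0 <= sig -> 0 <= tau ->
  (lam * sig + mu * tau) ^+ m <= lam * sig ^+ m + mu * tau ^+ m.
Proof.
move=> l0 m0 lm s0 t0; elim: m => [|m IH]; first by rewrite !expr0; lra.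
have h0 : 0 <= lam * sig + mu * tau by rewrite addr_ge0 ?mulr_ge0.
rewrite exprS (le_trans (ler_wpM2l h0 IH))//.
have mono : 0 <= (sig - tau) * (sig ^+ m - tau ^+ m).
  case: (leP sig tau) => st.
    by rewrite mulr_le0 ?subr_le0 ?lerXn2r ?nnegrE.
  by rewrite mulr_ge0 ?subr_ge0 ?lerXn2r ?nnegrE// ltW.
have := mulr_ge0 (mulr_ge0 l0 m0) mono.
have -> : lam = 1 - mu by lra.
rewrite !exprS; lra.
Qed.

(** Cauchy-Schwarz after convexity at half the exponent: this puts the squares of
    the weights on the right, at the cost of a factor 2. *)
Lemma exprn_convex_sqr lam mu sig tau m :
  0 <= lam -> 0 <= mu -> lam + mu = 1 -> 0 <= sig -> 0 <= tau ->
  (lam * sig + mu * tau) ^+ m.*2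
    <= 2 * (lam ^+ 2 * sig ^+ m.*2 + mu ^+ 2 * tau ^+ m.*2).
Proof.
move=> l0 m0 lm s0 t0.
have h0 : 0 <= lam * sig + mu * tau by rewrite addr_ge0 ?mulr_ge0.
have H := exprn_convex m l0 m0 lm s0 t0.
rewrite -muln2 !exprM (le_trans (lerXn2r 2 _ _ H)) ?nnegrE ?exprn_ge0//.
  by rewrite addr_ge0 ?mulr_ge0 ?exprn_ge0.
have := sqr_ge0 (lam * sig ^+ m - mu * tau ^+ m); lra.
Qed.

Lemma expr1D_le x y m : 0 <= x -> m%:R * x <= y -> y < 1 ->
  (1 + x) ^+ m * (1 - y) <= 1.
Proof.
move=> x0 mxy y1.
case: (posnP m) => [m0|m0]; first by move: mxy; rewrite m0 mul0r expr0; lra.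
have xy : x <= y.
  by apply: le_trans mxy; rewrite ler_peMl// ler1n.
have B : 1 - y <= (1 - x) ^+ m.
  apply: le_trans (bernoulli m (_ : -1 <= - x)); last by lra.
  rewrite mulrN; lra.
have p0 : 0 <= (1 + x) ^+ m by rewrite exprn_ge0//; lra.
apply: le_trans (ler_wpM2l p0 B) _.
rewrite -exprMn exprn_ile1//.
  by rewrite mulr_ge0//; lra.
by have := sqr_ge0 x; lra.
Qed.

(** A small weight [mu] cannot raise the mean noticeably unless
    [mu tau^(2l)] is much larger than [lam sig^(2l)].  With [y = tau / sig], the
    exponent [2l * mu (y - 1)] of the growth is controlled by applying Bernoulli's
    inequality to [y^l] only: [l (y - 1) <= y^l], whose square [y^(2l)] is at most
    [1 / (eps mu)], so the exponent is of order [sqrt (mu / eps)].  Bernoulli for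
    [y^(2l)] would lose the square root, hence all smallness in [mu]. *)
Lemma mean_le_dominant lam mu sig tau eps l :
  0 <= lam -> 0 <= mu -> lam + mu = 1 -> 0 <= sig -> 0 <= tau -> (0 < l)%N ->
  0 < eps -> eps <= 2^-1 -> 4 * mu <= eps ^+ 3 ->
  eps * (mu * tau ^+ l.*2) <= lam * sig ^+ l.*2 ->
  (lam * sig + mu * tau) ^+ l.*2 * (1 - eps) ^+ 2 <= lam * sig ^+ l.*2.
Proof.
move=> l0 m0 lm s0 t0 lpos e0 e2 me H.
have l2pos : (0 < l.*2)%N by rewrite double_gt0.
have leps : 1 - eps <= lam by nra.
have S0 : 0 <= sig ^+ l.*2 by rewrite exprn_ge0.
have [st|ts] := leP tau sig.
  have hs : lam * sig + mu * tau <= sig by nra.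
  have h0 : 0 <= lam * sig + mu * tau by rewrite addr_ge0 ?mulr_ge0.
  have P : (lam * sig + mu * tau) ^+ l.*2 <= sig ^+ l.*2 by rewrite lerXn2r ?nnegrE.
  have e3 : (1 - eps) ^+ 2 <= 1 - eps by nra.
  have e4 : 0 <= (1 - eps) ^+ 2 by apply: sqr_ge0.
  nra.
have [s0'|s0'] := eqVneq sig 0.
  move: H; rewrite s0' expr0n double_eq0 -[l == 0]negbK -lt0n lpos /= !mulr0 add0r.
  rewrite pmulr_rle0// => H.
  have T0 : 0 < tau ^+ l.*2 by rewrite exprn_gt0// -s0'.
  have -> : mu = 0 by apply: le_anti; rewrite m0 andbT -(pmulr_lle0 _ T0).
  by rewrite mul0r expr0n double_eq0 -[l == 0]negbK -lt0n lpos mul0r.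
have sp : 0 < sig by rewrite lt_neqAle eq_sym s0'.
pose y := tau / sig.
have ty : tau = sig * y by rewrite /y mulrCA divff// mulr1.
have y1 : 1 < y by rewrite /y ltr_pdivlMr// mul1r.
rewrite ty in H *.
have -> : lam * sig + mu * (sig * y) = sig * (1 + mu * (y - 1)).
  by rewrite (_ : lam = 1 - mu); [ring|lra].
rewrite exprMn.
have Hy : eps * (mu * y ^+ l.*2) <= 1.
  move: H; rewrite exprMn => H.
  have Sp : 0 < sig ^+ l.*2 by rewrite exprn_gt0.
  rewrite -(ler_pM2r Sp) mul1r; apply: le_trans (_ : lam * sig ^+ l.*2 <= _).
    by apply: le_trans H; rewrite le_eqVlt; apply/orP; left; apply/eqP; ring.
  by rewrite ler_piMl//; lra.
have x0 : 0 <= mu * (y - 1) by rewrite mulr_ge0// subr_ge0 ltW.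
have key : l.*2%:R * (mu * (y - 1)) <= eps.
  have B : l%:R * (y - 1) <= y ^+ l.
    have := @bernoulli (y - 1) l; rewrite addrCA subrr addr0 => /(_ _); lra.
  have B0 : 0 <= l%:R * (y - 1) by rewrite mulr_ge0 ?ler0n// subr_ge0 ltW.
  have B2 : (l%:R * (y - 1)) ^+ 2 <= y ^+ l.*2.
    by rewrite -muln2 exprM lerXn2r ?nnegrE// exprn_ge0// ltW// (lt_trans ltr01).
  have nn : 0 <= l.*2%:R * (mu * (y - 1)) by rewrite mulr_ge0 ?ler0n.
  rewrite -(@ler_pXn2r _ 2)// ?nnegrE ?(ltW e0)//.
  have -> : (l.*2%:R * (mu * (y - 1))) ^+ 2 =
     4 * mu ^+ 2 * (l%:R * (y - 1)) ^+ 2 by rewrite -mul2n natrM; ring.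
  have m20 : 0 <= 4 * mu ^+ 2 by rewrite mulr_ge0 ?sqr_ge0.
  apply: le_trans (ler_wpM2l m20 B2) _.
  rewrite -(ler_pM2l e0).
  have -> : eps * (4 * mu ^+ 2 * y ^+ l.*2) = (4 * mu) * (eps * (mu * y ^+ l.*2)) by ring.
  apply: le_trans (ler_wpM2l _ Hy) _; lra.
have e1 : eps < 1 by lra.
have F := expr1D_le x0 key e1.
have e1' : 0 <= 1 - eps by lra.
have -> A : sig ^+ l.*2 * A * (1 - eps) ^+ 2 = (1 - eps) * (A * (1 - eps)) * sig ^+ l.*2.
  by ring.
by rewrite ler_wpM2r// (le_trans _ leps)// ler_piMr//.
Qed.

(** Comparable [m]-th powers, up to a factor below [2^m], force the numbers
    themselves to be within a factor 2. *)
Lemma ratio_le2 lam mu sig tau eps m : 0 <= mu -> mu <= 1 -> 0 <= sig -> 0 <= tau ->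
  1 < 2 ^+ m * (eps * lam) -> eps * (lam * sig ^+ m) <= mu * tau ^+ m ->
  sig <= 2 * tau.
Proof.
move=> m0 m1 s0 t0 H1 H; rewrite leNgt; apply/negP => ts.
have sp : 0 < sig by rewrite (le_lt_trans _ ts)// mulr_ge0.
have T : (2 * tau) ^+ m <= sig ^+ m by rewrite lerXn2r ?nnegrE ?mulr_ge0// ltW.
have Sp : 0 < sig ^+ m by rewrite exprn_gt0.
have p2 : 0 <= 2 ^+ m :> R by rewrite exprn_ge0.
have := ler_wpM2l p2 H; apply/negP; rewrite -ltNge.
have -> : 2 ^+ m * (mu * tau ^+ m) = mu * (2 * tau) ^+ m by rewrite exprMn; ring.
rewrite (@le_lt_trans _ _ (sig ^+ m))//.
  by rewrite (le_trans _ T)// ler_piMl// exprn_ge0// mulr_ge0.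
by rewrite !mulrA -[X in X < _]mul1r ltr_pM2r// -mulrA.
Qed.

Lemma expr1B_le_inv x eps m : 0 <= x -> x <= 1 -> 0 < eps -> 1 <= m%:R * x * eps ->
  (1 - x) ^+ m <= eps.
Proof.
move=> x0 x1 e0 H.
have B : 1 + m%:R * x <= (1 + x) ^+ m by apply: bernoulli; lra.
have P : (1 - x) ^+ m * (1 + m%:R * x) <= 1.
  apply: le_trans (ler_wpM2l _ B) _; first by rewrite exprn_ge0// subr_ge0.
  rewrite -exprMn exprn_ile1//; first by rewrite mulr_ge0//; lra.
  by have := sqr_ge0 x; lra.
have Q : 0 <= (1 - x) ^+ m by rewrite exprn_ge0// subr_ge0.
have M0 : 0 <= m%:R * x by rewrite mulr_ge0.
have : (1 - x) ^+ m * 1 <= (1 - x) ^+ m * (m%:R * x * eps) by rewrite ler_wpM2l.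
nra.
Qed.

(** The dominant case of the two-point inequality: [U] pays for both terms, since
    [(1 - eps)^4 (1 + 8 eps) >= 1]. *)
Lemma two_point_dominant h X Y U eps m :
  0 < eps -> eps <= 8^-1 -> 0 <= h ->
  0 <= X -> 0 <= Y -> X <= h ^+ 2 -> Y <= h ^+ 2 ->
  h ^+ m * (1 - eps) ^+ 2 <= U ->
  X ^+ m + Y ^+ m <= 2 * (1 + 8 * eps) * U ^+ 2.
Proof.
move=> e0 e8 h0 X0 Y0 Xh Yh H.
have E : forall Z, 0 <= Z -> Z <= h ^+ 2 -> Z ^+ m <= (h ^+ m) ^+ 2.
  move=> Z Z0 Zh; rewrite exprAC lerXn2r ?nnegrE ?sqr_ge0//.
have EX := E _ X0 Xh; have EY := E _ Y0 Yh.
have hm0 : 0 <= h ^+ m by rewrite exprn_ge0.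
have q0 : 0 <= h ^+ m * (1 - eps) ^+ 2 by rewrite mulr_ge0 ?sqr_ge0.
have U0 := le_trans q0 H.
have S : (h ^+ m * (1 - eps) ^+ 2) ^+ 2 <= U ^+ 2 by rewrite lerXn2r ?nnegrE.
have F : 1 <= (1 - eps) ^+ 2 ^+ 2 * (1 + 8 * eps).
  have B : 1 - 2 * eps <= (1 - eps) ^+ 2 by have := sqr_ge0 eps; lra.
  have B2 : (1 - 2 * eps) ^+ 2 <= (1 - eps) ^+ 2 ^+ 2.
    by rewrite lerXn2r ?nnegrE ?sqr_ge0//; lra.
  have p : 0 <= 1 + 8 * eps by lra.
  by apply: le_trans (ler_wpM2r p B2); nra.
have p : 0 <= 1 + 8 * eps by lra.
have h20 : 0 <= (h ^+ m) ^+ 2 by apply: sqr_ge0.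
have := ler_wpM2l h20 F; have := ler_wpM2r p S; rewrite exprMn; nra.
Qed.

(** The balanced case.  The bound on [X + Y] gives [min X Y <= h^2 (1 - th)] with
    [th] of order [kap eps^3], because balance makes [lam * mu] at least of order
    [eps^3], and [sig * tau] at least of order [h^2].  The exponent [2l] is at
    least [1 / (th eps)], so the smaller term contributes at most [eps h^(4l)]. *)
Lemma two_point_balanced lam mu sig tau X Y kap eps l :
  0 <= lam -> 0 <= mu -> lam + mu = 1 -> 0 <= sig -> 0 <= tau ->
  0 < eps -> eps <= 8^-1 -> 0 < kap -> kap <= 1 ->
  8 <= l%:R * (kap * eps ^+ 4) ->
  let h := lam * sig + mu * tau in
  0 <= X -> 0 <= Y -> X <= h ^+ 2 -> Y <= h ^+ 2 ->
  X + Y <= 2 * h ^+ 2 - 4 * (lam * mu * kap * (sig * tau)) ->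
  eps ^+ 3 < 4 * lam -> eps ^+ 3 < 4 * mu ->
  eps * (lam * sig ^+ l.*2) < mu * tau ^+ l.*2 ->
  eps * (mu * tau ^+ l.*2) < lam * sig ^+ l.*2 ->
  X ^+ l.*2 + Y ^+ l.*2 <= (1 + eps) * h ^+ l.*2.*2.
Proof.
move=> l0 m0 lm s0 t0 e0 e8 k0 k1 L h X0 Y0 Xh Yh XY lam_big mu_big UV VU.
have h0 : 0 <= h by rewrite addr_ge0 ?mulr_ge0.
have sqE x : x ^+ l.*2.*2 = (x ^+ l.*2) ^+ 2 by rewrite -muln2 exprM.
have e3 : 0 < eps ^+ 3 by rewrite exprn_gt0.
have e4 : 0 < eps ^+ 4 by rewrite exprn_gt0.
have pow2 : 1 < 2 ^+ l.*2 * (eps ^+ 4 / 4).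
  have : (l.*2)%:R <= 2 ^+ l.*2 :> R by rewrite -natrX ler_nat ltnW// ltn_expl.
  rewrite -mul2n natrM => l2.
  have : l%:R * (kap * eps ^+ 4) <= l%:R * eps ^+ 4.
    by rewrite ler_wpM2l// ler_piMl// ltW.
  nra.
have [lam1 mu1] : lam <= 1 /\ mu <= 1 by split; lra.
have st : sig <= 2 * tau.
  apply: ratio_le2 (ltW UV) => //.
  apply: lt_le_trans pow2 _; rewrite ler_wpM2l ?exprn_ge0//; nra.
have ts : tau <= 2 * sig.
  apply: ratio_le2 (ltW VU) => //.
  apply: lt_le_trans pow2 _; rewrite ler_wpM2l ?exprn_ge0//; nra.
pose th := kap * (eps ^+ 3 / 16).
have e31 : eps ^+ 3 <= 1 by rewrite exprn_ile1//; lra.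
have th0 : 0 <= th by rewrite /th; nra.
have th1 : th <= 1 by rewrite /th; nra.
have gain : th * h ^+ 2 <= 2 * (lam * mu * kap * (sig * tau)).
  have h2 : h ^+ 2 <= 4 * (sig * tau).
    have hs : h <= 2 * sig by rewrite /h; nra.
    have ht : h <= 2 * tau by rewrite /h; nra.
    nra.
  have lm8 : eps ^+ 3 / 8 <= lam * mu by nra.
  apply: le_trans (ler_wpM2l th0 h2) _.
  have w : 0 <= kap * (sig * tau) by rewrite !mulr_ge0// ltW.
  have := ler_wpM2r w lm8; rewrite /th; lra.
have small : (1 - th) ^+ l.*2 <= eps.
  apply: expr1B_le_inv => //; rewrite /th -mul2n natrM.
  have -> : 2 * l%:R * (kap * (eps ^+ 3 / 16)) * eps = l%:R * (kap * eps ^+ 4) / 8 by field.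
  lra.
have minor Z : 0 <= Z -> Z <= h ^+ 2 * (1 - th) -> Z ^+ l.*2 <= eps * h ^+ l.*2.*2.
  move=> Z0 Zh.
  have h2th : 0 <= h ^+ 2 * (1 - th) by apply: le_trans Zh.
  have : Z ^+ l.*2 <= (h ^+ 2 * (1 - th)) ^+ l.*2 by rewrite lerXn2r ?nnegrE.
  rewrite exprMn exprAC -sqE => H; apply: le_trans H _.
  by rewrite mulrC ler_wpM2r// exprn_ge0.
have major Z : 0 <= Z -> Z <= h ^+ 2 -> Z ^+ l.*2 <= h ^+ l.*2.*2.
  by move=> Z0 Zh; rewrite sqE exprAC lerXn2r ?nnegrE ?sqr_ge0.
have [Xs|Xs] := leP X (h ^+ 2 * (1 - th)).
  by have := minor _ X0 Xs; have := major _ Y0 Yh; lra.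
have Ys : Y <= h ^+ 2 * (1 - th) by lra.
by have := minor _ Y0 Ys; have := major _ X0 Xh; lra.
Qed.

(** [X] and [Y] stand for the squared moduli of [lam u + mu w v] and
    [lam w u + mu v], where [|u| = sig], [|v| = tau] and [|w| = 1]; the bound on
    their sum is all that is retained of the phases. *)
Lemma two_point lam mu sig tau X Y kap eps l :
  0 <= lam -> 0 <= mu -> lam + mu = 1 -> 0 <= sig -> 0 <= tau ->
  0 < eps -> eps <= 8^-1 -> 0 < kap -> kap <= 1 ->
  8 <= l%:R * (kap * eps ^+ 4) ->
  let h := lam * sig + mu * tau in
  0 <= X -> 0 <= Y -> X <= h ^+ 2 -> Y <= h ^+ 2 ->
  X + Y <= 2 * h ^+ 2 - 4 * (lam * mu * kap * (sig * tau)) ->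
  X ^+ l.*2 + Y ^+ l.*2 <=
    2 * (1 + 8 * eps) * (lam ^+ 2 * sig ^+ l.*2.*2 + mu ^+ 2 * tau ^+ l.*2.*2).
Proof.
move=> l0 m0 lm s0 t0 e0 e8 k0 k1 L h X0 Y0 Xh Yh XY.
have h0 : 0 <= h by rewrite addr_ge0 ?mulr_ge0.
have e2 : eps <= 2^-1 by lra.
have lpos : (0 < l)%N.
  by rewrite lt0n; apply/eqP => l00; move: L; rewrite l00 mul0r; lra.
have sqE x : x ^+ l.*2.*2 = (x ^+ l.*2) ^+ 2 by rewrite -muln2 exprM.
have sq x y : x ^+ 2 * y ^+ l.*2.*2 = (x * y ^+ l.*2) ^+ 2 by rewrite sqE exprMn.
have [U0 V0] : 0 <= lam * sig ^+ l.*2 /\ 0 <= mu * tau ^+ l.*2.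
  by split; rewrite mulr_ge0 ?exprn_ge0.
have dominantl : h ^+ l.*2 * (1 - eps) ^+ 2 <= lam * sig ^+ l.*2 ->
    X ^+ l.*2 + Y ^+ l.*2 <=
    2 * (1 + 8 * eps) * (lam ^+ 2 * sig ^+ l.*2.*2 + mu ^+ 2 * tau ^+ l.*2.*2).
  move=> D; apply: le_trans (two_point_dominant e0 e8 h0 X0 Y0 Xh Yh D) _.
  by rewrite ler_wpM2l//; [lra|rewrite -sq lerDl sq sqr_ge0].
have dominantr : h ^+ l.*2 * (1 - eps) ^+ 2 <= mu * tau ^+ l.*2 ->
    X ^+ l.*2 + Y ^+ l.*2 <=
    2 * (1 + 8 * eps) * (lam ^+ 2 * sig ^+ l.*2.*2 + mu ^+ 2 * tau ^+ l.*2.*2).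
  move=> D; apply: le_trans (two_point_dominant e0 e8 h0 X0 Y0 Xh Yh D) _.
  by rewrite ler_wpM2l//; [lra|rewrite -sq lerDr sq sqr_ge0].
have convex := exprn_convex l.*2 l0 m0 lm s0 t0.
have de : (1 - eps) ^+ 2 * (1 + eps) <= 1.
  have := sqr_ge0 eps; nra.
(* One of the two summands of the mean of powers is negligible. *)
have [VU|UV] := leP (mu * tau ^+ l.*2) (eps * (lam * sig ^+ l.*2)).
  apply: dominantl; apply: le_trans (ler_wpM2r (sqr_ge0 _) convex) _.
  have c : lam * sig ^+ l.*2 + mu * tau ^+ l.*2 <= (1 + eps) * (lam * sig ^+ l.*2) by lra.
  apply: le_trans (ler_wpM2r (sqr_ge0 _) c) _.
  by rewrite mulrAC [(1 + _) * _]mulrC ler_piMl.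
have [UV'|VU] := leP (lam * sig ^+ l.*2) (eps * (mu * tau ^+ l.*2)).
  apply: dominantr; apply: le_trans (ler_wpM2r (sqr_ge0 _) convex) _.
  have c : lam * sig ^+ l.*2 + mu * tau ^+ l.*2 <= (1 + eps) * (mu * tau ^+ l.*2) by lra.
  apply: le_trans (ler_wpM2r (sqr_ge0 _) c) _.
  by rewrite mulrAC [(1 + _) * _]mulrC ler_piMl.
(* Both summands matter, but one of the weights is tiny. *)
have [mu_small|mu_big] := leP (4 * mu) (eps ^+ 3).
  by apply: dominantl; apply: mean_le_dominant => //; apply: ltW.
have [lam_small|lam_big] := leP (4 * lam) (eps ^+ 3).
  apply: dominantr; rewrite /h [X in X ^+ _ * _]addrC.
  by apply: mean_le_dominant => //; [rewrite addrC|apply: ltW].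
have total : X ^+ l.*2 + Y ^+ l.*2 <= (1 + eps) * h ^+ l.*2.*2.
  exact: (two_point_balanced l0 m0 lm s0 t0 e0 e8 k0 k1 L).
have := exprn_convex_sqr l.*2 l0 m0 lm s0 t0.
rewrite -/h !sq => Q; apply: le_trans total _.
set W := _ ^+ 2 + _ ^+ 2 in Q *.
have W0 : 0 <= W by rewrite addr_ge0 ?sqr_ge0.
have e1 : 0 <= 1 + eps by lra.
have := ler_wpM2l e1 Q; nra.
Qed.

End TwoPoint.

(** * Two-point inequality for a rotation *)

Section Vec.
Variable R : rcfType.
Implicit Types (lam mu eps kap c s : R) (l : nat).

Lemma dot_le_norms (u1 u2 w1 w2 sig tau : R) : 0 <= sig -> 0 <= tau ->
  u1 ^+ 2 + u2 ^+ 2 = sig ^+ 2 -> w1 ^+ 2 + w2 ^+ 2 = tau ^+ 2 ->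
  u1 * w1 + u2 * w2 <= sig * tau.
Proof.
move=> s0 t0 Es Et; have st0 : 0 <= sig * tau by rewrite mulr_ge0.
apply: le_trans (ler_norm _) _; rewrite -(ger0_norm st0) -ler_sqr ?nnegrE//.
rewrite !real_normK ?num_real// exprMn -Es -Et.
by have := sqr_ge0 (u1 * w2 - u2 * w1); lra.
Qed.

(** Complex numbers are spelled out as pairs of reals: [u1, u2] and [v1, v2] are
    the coordinates of [u] and [v], and [c, s] those of [w].  The two cross terms
    are [Re (conj u w v)] and [Re (conj u conj(w) v)]; they add up to
    [2 c Re (conj u v)], which explains the factor [1 - kap]. *)
Lemma two_point_rotation lam mu eps kap c s (u1 u2 v1 v2 : R) l :
  0 <= lam -> 0 <= mu -> lam + mu = 1 ->
  0 < eps -> eps <= 8^-1 -> 0 < kap ->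
  c ^+ 2 + s ^+ 2 = 1 -> `|c| <= 1 - kap ->
  8 <= l%:R * (kap * eps ^+ 4) ->
  ((lam * u1 + mu * (c * v1 - s * v2)) ^+ 2 +
   (lam * u2 + mu * (s * v1 + c * v2)) ^+ 2) ^+ l.*2 +
  ((lam * (c * u1 - s * u2) + mu * v1) ^+ 2 +
   (lam * (s * u1 + c * u2) + mu * v2) ^+ 2) ^+ l.*2 <=
  2 * (1 + 8 * eps) *
  (lam ^+ 2 * (u1 ^+ 2 + u2 ^+ 2) ^+ l.*2 + mu ^+ 2 * (v1 ^+ 2 + v2 ^+ 2) ^+ l.*2).
Proof.
move=> l0 m0 lm e0 e8 k0 cs ck L.
pose sig := Num.sqrt (u1 ^+ 2 + u2 ^+ 2); pose tau := Num.sqrt (v1 ^+ 2 + v2 ^+ 2).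
have s0 : 0 <= sig by apply: sqrtr_ge0.
have t0 : 0 <= tau by apply: sqrtr_ge0.
have Es : u1 ^+ 2 + u2 ^+ 2 = sig ^+ 2 by rewrite sqr_sqrtr// addr_ge0 ?sqr_ge0.
have Et : v1 ^+ 2 + v2 ^+ 2 = tau ^+ 2 by rewrite sqr_sqrtr// addr_ge0 ?sqr_ge0.
have k1 : kap <= 1 by have := normr_ge0 c; lra.
rewrite Es Et -!exprM !mul2n.
have lm0 : 0 <= lam * mu by rewrite mulr_ge0.
have st0 : 0 <= sig * tau by rewrite mulr_ge0.
have Ewv : (c * v1 - s * v2) ^+ 2 + (s * v1 + c * v2) ^+ 2 = tau ^+ 2.
  by rewrite -Et -[RHS]mul1r -cs; ring.
have Ewu : (c * u1 - s * u2) ^+ 2 + (s * u1 + c * u2) ^+ 2 = sig ^+ 2.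
  by rewrite -Es -[RHS]mul1r -cs; ring.
have D1 := dot_le_norms s0 t0 Es Ewv.
have D2 := dot_le_norms s0 t0 Ewu Et.
have D3 : c * (u1 * v1 + u2 * v2) <= (1 - kap) * (sig * tau).
  apply: le_trans (ler_norm _) _; rewrite normrM ler_pM//.
  rewrite ler_norml; apply/andP; split; last exact: dot_le_norms.
  have := @dot_le_norms (- u1) (- u2) v1 v2 sig tau s0 t0; rewrite !sqrrN => /(_ Es Et).
  lra.
have X1 : (lam * u1 + mu * (c * v1 - s * v2)) ^+ 2 +
   (lam * u2 + mu * (s * v1 + c * v2)) ^+ 2 = lam ^+ 2 * sig ^+ 2 + mu ^+ 2 * tau ^+ 2
   + 2 * (lam * mu) * (u1 * (c * v1 - s * v2) + u2 * (s * v1 + c * v2)).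
  by rewrite -Es -Ewv; ring.
have Y1 : (lam * (c * u1 - s * u2) + mu * v1) ^+ 2 +
   (lam * (s * u1 + c * u2) + mu * v2) ^+ 2 = lam ^+ 2 * sig ^+ 2 + mu ^+ 2 * tau ^+ 2
   + 2 * (lam * mu) * ((c * u1 - s * u2) * v1 + (s * u1 + c * u2) * v2).
  by rewrite -Ewu -Et; ring.
apply: (two_point l0 m0 lm s0 t0 e0 e8 k0 k1 L).
- by rewrite addr_ge0 ?sqr_ge0.
- by rewrite addr_ge0 ?sqr_ge0.
- by rewrite X1; have := ler_wpM2l lm0 D1; lra.
- by rewrite Y1; have := ler_wpM2l lm0 D2; lra.
- by rewrite X1 Y1; have := ler_wpM2l lm0 D3; lra.
Qed.

End Vec.

(** * Moments of the Fourier transform of a set of words *)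

(** Points of the cube are handled as words over [bool], for which splitting off
    the first coordinate is the definition itself. *)
Fixpoint words n : seq (seq bool) :=
  if n is n'.+1 then map (cons true) (words n') ++ map (cons false) (words n')
  else [:: [::]].

Fixpoint hamming (x y : seq bool) : nat :=
  match x, y with
  | a :: x', b :: y' => (a (+) b) + hamming x' y'
  | _, _ => 0
  end.

Lemma mem_words n w : (w \in words n) = (size w == n).
Proof.
elim: n w => [|n IH] [|b w]; rewrite /= ?mem_seq1// mem_cat.
  by apply/orP => -[] /mapP[].
rewrite eqSS -IH; case: b.
- rewrite mem_map; last by move=> ? ? [].
  by case: (w \in _) => //=; apply/mapP => -[].
- rewrite orbC mem_map; last by move=> ? ? [].
  by case: (w \in _) => //=; apply/mapP => -[].
Qed.

Lemma uniq_words n : uniq (words n).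
Proof.
elim: n => //= n IH; rewrite cat_uniq !map_inj_uniq ?IH/= ?andbT; first last.
- by move=> ? ? [].
- by move=> ? ? [].
by apply/hasPn => w /mapP[v _ ->]; apply/mapP => -[].
Qed.

Section Fourier.
Variable R : realType.
Implicit Types (a : R) (n l : nat) (B : pred (seq bool)) (x : seq bool).

Definition cosum a n B x : R := \sum_(y <- words n | B y) cos (a * (hamming x y)%:R).
Definition sinsum a n B x : R := \sum_(y <- words n | B y) sin (a * (hamming x y)%:R).
(** The squared modulus of the mean of [exp (i a d(x, y))] over [y] in [B]; it is 0
    for empty [B], by the convention on division by 0, and this convention is what
    the recursion needs when one half of [B] is empty. *)
Definition fourier_sqr a n B x : R :=
  (cosum a n B x / (count B (words n))%:R) ^+ 2 +
  (sinsum a n B x / (count B (words n))%:R) ^+ 2.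

Lemma count_words n B : count B (words n.+1) =
  (count (B \o cons true) (words n) + count (B \o cons false) (words n))%N.
Proof. by rewrite /= count_cat !count_map. Qed.

Lemma big_words n (P : pred (seq bool)) (F : seq bool -> R) :
  \sum_(y <- words n.+1 | P y) F y =
  \sum_(y <- words n | P (true :: y)) F (true :: y) +
  \sum_(y <- words n | P (false :: y)) F (false :: y).
Proof. by rewrite /= big_cat !big_map. Qed.

Lemma cosum_cons a n B b x :
  cosum a n.+1 B (b :: x) = cosum a n (B \o cons b) x +
   (cos a * cosum a n (B \o cons (~~ b)) x - sin a * sinsum a n (B \o cons (~~ b)) x).
Proof.
have E : \sum_(y <- words n | B (~~ b :: y)) cos (a * (hamming (b :: x) (~~ b :: y))%:R)
  = cos a * cosum a n (B \o cons (~~ b)) x - sin a * sinsum a n (B \o cons (~~ b)) x.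
  rewrite /cosum /sinsum !mulr_sumr -sumrB; apply: eq_bigr => y _ /=.
  by rewrite addbN addbb natrD mulrDr mulr1 cosD.
rewrite -E /cosum big_words; case: b {E} => //=; by rewrite addrC.
Qed.

Lemma sinsum_cons a n B b x :
  sinsum a n.+1 B (b :: x) = sinsum a n (B \o cons b) x +
   (sin a * cosum a n (B \o cons (~~ b)) x + cos a * sinsum a n (B \o cons (~~ b)) x).
Proof.
have E : \sum_(y <- words n | B (~~ b :: y)) sin (a * (hamming (b :: x) (~~ b :: y))%:R)
  = sin a * cosum a n (B \o cons (~~ b)) x + cos a * sinsum a n (B \o cons (~~ b)) x.
  rewrite /cosum /sinsum !mulr_sumr -big_split; apply: eq_bigr => y _ /=.
  by rewrite addbN addbb natrD mulrDr mulr1 sinD.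
rewrite -E /sinsum big_words; case: b {E} => //=; by rewrite addrC.
Qed.

Lemma big_count0 n B (F : seq bool -> R) :
  count B (words n) = 0%N -> \sum_(y <- words n | B y) F y = 0.
Proof.
by move=> /eqP B0; rewrite big_hasC// has_count -leqNgt leqn0.
Qed.

(** Induction on [n]: the mean over [B] is the combination, with weights [lam] and
    [mu], of the means over its two halves, one of them rotated by [exp (i a)].
    The factor [#|B|] on the left turns [lam^2] and [mu^2] into
    [lam * #|B1|] and [mu * #|B0|], ready for the induction hypothesis. *)
Lemma fourier_moment_le a n B (eps : R) l : 0 < eps -> eps <= 8^-1 ->
  `|cos a| < 1 -> 8 <= l%:R * ((1 - `|cos a|) * eps ^+ 4) ->
  (count B (words n))%:R * (\sum_(x <- words n) fourier_sqr a n B x ^+ l.*2)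
    <= (2 * (1 + 8 * eps)) ^+ n.
Proof.
move=> e0 e8 c1 L.
have lpos : (0 < l)%N.
  by rewrite lt0n; apply/eqP => l00; move: L; rewrite l00 mul0r; lra.
elim: n B => [|n IH] B.
  rewrite expr0 /= big_seq1 /fourier_sqr /cosum /sinsum !big_cons !big_nil /= addn0.
  case: (B [::]); rewrite ?mul0r ?ler01//= !mulr0 cos0 sin0 !addr0 mul0r divr1.
  by rewrite expr1n expr0n addr0 expr1n mulr1.
set K := 2 * _.
have K0 : 0 <= K by rewrite /K; lra.
set N := (count B (words n.+1))%:R : R.
have [N0|N0] := eqVneq N 0; first by rewrite N0 mul0r exprn_ge0.
have Np : 0 < N by rewrite lt_neqAle eq_sym N0 ler0n.
pose B1 := B \o cons true; pose B0 := B \o cons false.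
pose N1 := (count B1 (words n))%:R : R; pose M0 := (count B0 (words n))%:R : R.
have NE : N = N1 + M0 by rewrite /N count_words natrD.
pose lam := N1 / N; pose mu := M0 / N.
have l0 : 0 <= lam by rewrite divr_ge0// ler0n.
have m0 : 0 <= mu by rewrite divr_ge0// ler0n.
have lm : lam + mu = 1 by rewrite /lam /mu -mulrDl -NE divff.
have D1 (F : seq bool -> R) : (\sum_(y <- words n | B1 y) F y) / N =
    lam * ((\sum_(y <- words n | B1 y) F y) / N1).
  have [N10|N10] := eqVneq N1 0; last by rewrite /lam; field; rewrite N10.
  rewrite big_count0 ?mul0r ?mulr0//; apply/eqP.
  by rewrite -(pnatr_eq0 R) -/N1 N10.
have D0 (F : seq bool -> R) : (\sum_(y <- words n | B0 y) F y) / N =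
    mu * ((\sum_(y <- words n | B0 y) F y) / M0).
  have [N10|N10] := eqVneq M0 0; last by rewrite /mu; field; rewrite N10.
  rewrite big_count0 ?mul0r ?mulr0//; apply/eqP.
  by rewrite -(pnatr_eq0 R) -/M0 N10.
have step x : fourier_sqr a n.+1 B (true :: x) ^+ l.*2 + fourier_sqr a n.+1 B (false :: x) ^+ l.*2
   <= K * (lam ^+ 2 * fourier_sqr a n B1 x ^+ l.*2 + mu ^+ 2 * fourier_sqr a n B0 x ^+ l.*2).
  have T := two_point_rotation (cosum a n B1 x / N1) (sinsum a n B1 x / N1)
     (cosum a n B0 x / M0) (sinsum a n B0 x / M0) l0 m0 lm e0 e8 _ (cos2Dsin2 a) _ L.
  apply: le_trans (T _ _); [|lra|lra].
  rewrite /fourier_sqr !cosum_cons !sinsum_cons -/N /= -/B0 -/B1.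
  have C1 := D1 (fun y => cos (a * (hamming x y)%:R)); rewrite -/(cosum a n B1 x) in C1.
  have C0 := D0 (fun y => cos (a * (hamming x y)%:R)); rewrite -/(cosum a n B0 x) in C0.
  have S1 := D1 (fun y => sin (a * (hamming x y)%:R)); rewrite -/(sinsum a n B1 x) in S1.
  have S0 := D0 (fun y => sin (a * (hamming x y)%:R)); rewrite -/(sinsum a n B0 x) in S0.
  have lin (p q r s t : R) : (p + (s * q + t * r)) / N = p / N + (s * (q / N) + t * (r / N)).
    by ring.
  rewrite -!mulNr !lin C1 C0 S1 S0 le_eqVlt; apply/orP; left; apply/eqP.
  by congr (_ ^+ _ + _ ^+ _); ring.
rewrite big_words -big_split /=.
have IH1 := IH B1; have IH0 := IH B0.
set P1 := \sum_(x <- words n) fourier_sqr a n B1 x ^+ l.*2 in IH1.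
set P0 := \sum_(x <- words n) fourier_sqr a n B0 x ^+ l.*2 in IH0.
have Hs : \sum_(x <- words n) (fourier_sqr a n.+1 B (true :: x) ^+ l.*2 +
     fourier_sqr a n.+1 B (false :: x) ^+ l.*2) <= K * (lam ^+ 2 * P1 + mu ^+ 2 * P0).
  rewrite /P1 /P0 !mulr_sumr -big_split /= mulr_sumr.
  by apply: ler_sum => x _; exact: step.
apply: le_trans (ler_wpM2l (ler0n _ _) Hs) _; rewrite -/N.
have -> : N * (K * (lam ^+ 2 * P1 + mu ^+ 2 * P0)) =
   K * (lam * (N1 * P1) + mu * (M0 * P0)) by rewrite /lam /mu; field.
rewrite exprS ler_wpM2l//.
have -> : K ^+ n = lam * K ^+ n + mu * K ^+ n by rewrite -mulrDl lm mul1r.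
by rewrite lerD// ler_wpM2l.
Qed.

End Fourier.

(** * Trigonometric estimates *)

Section Analytic.
Variable R : realType.

Lemma sin_ge_mul_cos (x : R) : 0 <= x -> x <= pi -> x * cos x <= sin x.
Proof.
rewrite le_eqVlt => /predU1P[<-|x0] xpi; first by rewrite mul0r sin0.
have [|c] := @MVT R sin cos 0 x x0 (fun y _ => is_derive_sin y).
  exact/continuous_subspaceT/continuous_sin.
rewrite in_itv /= => /andP[c0 cx]; rewrite sin0 !subr0 => ->.
rewrite mulrC ler_wpM2r ?(ltW x0)// ltW// ltr_cos// in_itv /=.
  by rewrite (ltW c0) (le_trans (ltW cx)).
by rewrite (ltW x0).
Qed.

(** Applying [x cos x <= sin x] at [x / 2] and using the duplication formula turns
    it into [x (1 + cos x) / 2 <= sin x]. *)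
Lemma sin_ge_half (x : R) : 0 <= x -> x <= pi / 2 -> x / 2 <= sin x.
Proof.
move=> x0 xpi.
have c0 : 0 <= cos x by rewrite cos_ge0_pihalf//; have := pi_ge0 R; lra.
have h : x = x / 2 + x / 2 by lra.
have cx2 : cos (x / 2) ^+ 2 = (1 + cos x) / 2.
  by rewrite [in RHS]h cosD; have := cos2Dsin2 (x / 2); lra.
have ch0 : 0 <= cos (x / 2) by rewrite cos_ge0_pihalf//; lra.
have S : x / 2 * cos (x / 2) <= sin (x / 2) by apply: sin_ge_mul_cos; lra.
rewrite [in leRHS]h sinD.
have := ler_wpM2l ch0 S.
have -> : cos (x / 2) * (x / 2 * cos (x / 2)) = x / 2 * cos (x / 2) ^+ 2 by ring.
rewrite cx2; have := mulr_ge0 x0 c0; lra.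
Qed.

Lemma oneB_abs_cos_ge (a : R) : sin a ^+ 2 / 2 <= 1 - `|cos a|.
Proof.
rewrite sin2cos2 -(real_normK (num_real (cos a))).
have := cos_max a; have := normr_ge0 (cos a); nra.
Qed.

(** The distance from [pi t / p] to the multiples of [pi] is [pi / p] times
    [minn t (p - t)]. *)
Lemma oneB_abs_cos_frac_ge (t p : nat) : (0 < p)%N -> (t <= p)%N ->
  (minn t (p - t))%:R ^+ 2 / (2 * p%:R ^+ 2)
    <= 1 - `|cos (pi * t%:R / p%:R)| :> R.
Proof.
move=> p0 tp.
have P0 : 0 < p%:R :> R by rewrite ltr0n.
have half u : (u.*2 <= p)%N ->
    u%:R ^+ 2 / (2 * p%:R ^+ 2) <= 1 - `|cos (pi * u%:R / p%:R)| :> R.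
  move=> up; apply: le_trans (oneB_abs_cos_ge _).
  have up' : 2 * u%:R <= p%:R :> R by rewrite -natrM mul2n ler_nat.
  have x0 : 0 <= pi * u%:R / p%:R :> R by rewrite !mulr_ge0 ?invr_ge0 ?pi_ge0.
  have S : pi * u%:R / p%:R / 2 <= sin (pi * u%:R / p%:R) :> R.
    apply: sin_ge_half => //; rewrite ler_pdivrMr//.
    by have := ler_wpM2l (pi_ge0 R) up'; lra.
  have S2 : u%:R / p%:R <= sin (pi * u%:R / p%:R) :> R.
    apply: le_trans S; have := pi_ge2 R.
    have : 0 <= u%:R / p%:R :> R by rewrite divr_ge0.
    have -> : pi * u%:R / p%:R / 2 = (pi / 2) * (u%:R / p%:R) :> R by ring.
    by nra.
  have q0 : 0 <= u%:R / p%:R :> R by rewrite divr_ge0.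
  have : (u%:R / p%:R) ^+ 2 <= sin (pi * u%:R / p%:R) ^+ 2 :> R.
    by rewrite lerXn2r ?nnegrE// (le_trans q0 S2).
  by rewrite invfM expr_div_n; lra.
have [tle|tgt] := leqP t (p - t).
  by rewrite half//; lia.
have -> : `|cos (pi * t%:R / p%:R)| = `|cos (pi * (p - t)%:R / p%:R)| :> R.
  have -> : pi * (p - t)%:R / p%:R = - (pi * t%:R / p%:R) + pi :> R.
    by rewrite natrB//; field; rewrite gt_eqF.
  by rewrite cosDpi cosN normrN.
by rewrite half//; lia.
Qed.

(** The terms are compared with the telescoping differences of
    [1 / (sqrt n + j)], using [(sqrt n + j)^2 <= 2 (n + j^2)]. *)
Lemma sum_inv1Dsqr_le (b : R) (n p : nat) : 0 < b -> b <= 1 -> (0 < n)%N ->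
  \sum_(0 <= j < p) (1 + b * j%:R ^+ 2 / n%:R)^-1 <= 4 / b * Num.sqrt n%:R :> R.
Proof.
move=> b0 b1 n0; set s := Num.sqrt _.
have N0 : 0 < n%:R :> R by rewrite ltr0n.
have s2 : s ^+ 2 = n%:R by rewrite sqr_sqrtr.
have s1 : 1 <= s by rewrite -sqrtr1 ler_sqrt// ler1n.
have s0 : 0 < s by lra.
have term j : (1 + b * j%:R ^+ 2 / n%:R)^-1 <=
    4 / b * n%:R * ((s + j%:R)^-1 - (s + j.+1%:R)^-1).
  have j0 : 0 <= j%:R :> R by [].
  have -> : (s + j%:R)^-1 - (s + j.+1%:R)^-1 = ((s + j%:R) * (s + j.+1%:R))^-1.
    rewrite -natr1; field; apply/andP; split; apply: lt0r_neq0; lra.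
  have d0 : 0 < (s + j%:R) * (s + j.+1%:R) by rewrite -natr1 mulr_gt0//; lra.
  rewrite ler_pdivlMr// mulrC ler_pdivrMr; last first.
    by rewrite ltr_wpDr// divr_ge0// mulr_ge0 ?sqr_ge0// ltW.
  have -> : 4 / b * n%:R * (1 + b * j%:R ^+ 2 / n%:R) = 4 * (s ^+ 2 / b + j%:R ^+ 2).
    by rewrite s2; field; rewrite !gt_eqF.
  have : s ^+ 2 <= s ^+ 2 / b by rewrite ler_peMr ?sqr_ge0// invf_ge1.
  rewrite -natr1; have := sqr_ge0 (s - j%:R); nra.
apply: le_trans (ler_sum _ (fun j _ => term j)) _.
rewrite -mulr_sumr (_ : \sum_(_ <= _ < _) _ = s^-1 - (s + p%:R)^-1); last first.
  elim: p => [|p IH]; first by rewrite big_nil addr0 subrr.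
  by rewrite big_nat_recr//= IH; ring.
have -> : 4 / b * s = 4 / b * n%:R * s^-1.
  by rewrite -s2; field; rewrite !gt_eqF.
rewrite ler_wpM2l ?mulr_ge0 ?invr_ge0 ?(ltW b0)// gerBl invr_ge0.
by rewrite addr_ge0// ltW.
Qed.

(** Multiplying by [2 sin h], with [h] half the angle step, makes the sum telescope
    over a whole number of periods. *)
Lemma sum_cos_eq0 (p z : nat) : (0 < z)%N -> (z < p.*2)%N ->
  \sum_(0 <= t < p.*2) cos (pi * t%:R / p%:R * z%:R) = 0 :> R.
Proof.
move=> z0 zp.
have p0 : (0 < p)%N by lia.
have P0 : 0 < p%:R :> R by rewrite ltr0n.
pose h : R := pi * z%:R / p.*2%:R.
have hE : h = pi * z%:R / (2 * p%:R) by rewrite /h -mul2n natrM.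
have hs : 0 < sin h.
  apply: sin_gt0_pi; apply/andP; split.
    by rewrite !mulr_gt0 ?pi_gt0 ?invr_gt0 ?ltr0n// double_gt0.
  rewrite /h ltr_pdivrMr ?ltr0n ?double_gt0//.
  by rewrite ltr_pM2l ?pi_gt0// ltr_nat.
have tel m : 2 * sin h * (\sum_(0 <= t < m) cos (pi * t%:R / p%:R * z%:R)) =
    sin (h * (2 * m%:R) - h) + sin h.
  elim: m => [|m IH]; first by rewrite big_nil !mulr0 sub0r sinN addNr.
  rewrite big_nat_recr//= mulrDr IH.
  have -> : pi * m%:R / p%:R * z%:R = h * (2 * m%:R) :> R.
    by rewrite hE; field; rewrite gt_eqF.
  have -> : h * (2 * m.+1%:R) - h = h * (2 * m%:R) + h by rewrite -natr1; ring.
  by rewrite sinB sinD; ring.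
have := tel p.*2.
have -> : h * (2 * p.*2%:R) - h = - h + pi *+ 2 *+ z.
  rewrite hE -mul2n natrM -mulrnA -(mulr_natr pi) natrM; field; by rewrite gt_eqF.
rewrite (periodicn (@sinD2pi R)) sinN addNr => /eqP.
by rewrite mulf_eq0 (gt_eqF (mulr_gt0 _ hs))// => /eqP.
Qed.

Lemma sum_cos_delta (p z k : nat) : (z < p)%N -> (k < p)%N ->
  \sum_(0 <= t < p.*2) cos (pi * t%:R / p%:R * z%:R - pi * t%:R / p%:R * k%:R)
    = (z == k)%:R * p.*2%:R :> R.
Proof.
move=> zp kp; case: eqP => [->|/eqP zk].
  under eq_bigr do rewrite subrr cos0.
  by rewrite sumr_const_nat subn0 mul1r.
rewrite mul0r; move: zk; rewrite neq_ltn => /orP[lt|lt].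
  rewrite -[RHS](@sum_cos_eq0 p (k - z)); [|lia|lia].
  by apply: eq_bigr => t _; rewrite -cosN opprB -mulrBr natrB// ltnW.
rewrite -[RHS](@sum_cos_eq0 p (z - k)); [|lia|lia].
by apply: eq_bigr => t _; rewrite -mulrBr natrB// ltnW.
Qed.

End Analytic.

(** * Point probabilities and averages over directions *)

Lemma hamming_le_size x y : (hamming x y <= size y)%N.
Proof.
elim: x y => [|a x IH] [|b y] //=; have := IH y; case: (a (+) b) => /=; lia.
Qed.

Section PointProb.
Variable R : realType.
Implicit Types (n : nat) (B : pred (seq bool)) (x : seq bool).

Definition freq n t : R := pi * t%:R / n.+1%:R.

Definition fourier_abs n B t x : R := Num.sqrt (fourier_sqr (freq n t) n B x).

Lemma fourier_sqr_ge0 a n B x : 0 <= fourier_sqr a n B x :> R.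
Proof. by rewrite addr_ge0 ?sqr_ge0. Qed.

Lemma fourier_projection_le n B x t (b : R) :
  cos b * cosum (freq n t) n B x + sin b * sinsum (freq n t) n B x <=
  (count B (words n))%:R * fourier_abs n B t x.
Proof.
rewrite /fourier_abs /fourier_sqr.
set N := (count _ _)%:R; set c := cosum _ _ _ _; set s := sinsum _ _ _ _.
have [N0|N0] := eqVneq N 0.
  have B0 : count B (words n) = 0%N by apply/eqP; rewrite -(pnatr_eq0 R) -/N N0.
  by rewrite /c /s /cosum /sinsum !big_count0// !mulr0 N0 mul0r addr0.
have Np : 0 < N by rewrite lt_neqAle eq_sym N0 ler0n.
have F0 : 0 <= (c / N) ^+ 2 + (s / N) ^+ 2 by rewrite addr_ge0 ?sqr_ge0.
have := @dot_le_norms R (cos b) (sin b) (c / N) (s / N) 1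
  (Num.sqrt ((c / N) ^+ 2 + (s / N) ^+ 2)) ler01 (sqrtr_ge0 _).
rewrite sqr_sqrtr// cos2Dsin2 expr1n => /(_ erefl erefl).
rewrite mul1r => /(ler_wpM2l (ltW Np)); apply: le_trans.
by rewrite le_eqVlt; apply/orP; left; apply/eqP; field.
Qed.

(** Fourier inversion on the cyclic group of order [2(n+1)], where the distances
    [0, ..., n] are distinct.  The doubling makes the angles multiples of
    [pi / (n+1)], so that [|cos|] has period [n+1] in [t]. *)
Lemma point_prob_le n B x k : (k <= n)%N ->
  (count [pred y | B y && (hamming x y == k)] (words n))%:R
     / (count B (words n))%:R <=
  (n.+1.*2%:R)^-1 * \sum_(0 <= t < n.+1.*2) fourier_abs n B t x :> R.
Proof.
move=> kn; set N := (count B _)%:R; set c := (count _ _)%:R.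
set S := \sum_(_ <= _ < _) _.
have S0 : 0 <= S by apply: sumr_ge0 => t _; apply: sqrtr_ge0.
have [N0|N0] := eqVneq N 0; first by rewrite N0 invr0 mulr0 mulr_ge0 ?invr_ge0.
have Np : 0 < N by rewrite lt_neqAle eq_sym N0 ler0n.
have P0 : 0 < n.+1.*2%:R :> R by rewrite ltr0n.
rewrite ler_pdivrMr// mulrAC -mulrA ler_pdivlMl//.
have -> : n.+1.*2%:R * c = \sum_(0 <= t < n.+1.*2)
   (cos (freq n t * k%:R) * cosum (freq n t) n B x
    + sin (freq n t * k%:R) * sinsum (freq n t) n B x).
  rewrite /c -sum1_count natr_sum mulr_sumr big_mkcondr /=.
  under [RHS]eq_bigr => t _.
    rewrite /cosum /sinsum !mulr_sumr -big_split /=.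
    under eq_bigr do rewrite [cos _ * cos _]mulrC [sin _ * sin _]mulrC -cosB.
    over.
  rewrite exchange_big /= big_seq_cond [RHS]big_seq_cond; apply: eq_bigr => y /andP[yw _].
  rewrite sum_cos_delta ?ltnS//; last first.
    by rewrite (leq_trans (hamming_le_size _ _))//; move: yw; rewrite mem_words => /eqP->.
  by case: eqP; rewrite ?mul1r ?mulr1 ?mul0r.
by rewrite mulr_sumr; apply: ler_sum => t _; apply: fourier_projection_le.
Qed.

(** Splitting a number at the threshold [r] in this way replaces the use of
    Hoelder's inequality, and of roots, in deducing first moments from [q]-th
    moments. *)
Lemma le_add_exprn_div (x r : R) q : 0 <= x -> 0 < r -> (0 < q)%N ->
  x <= r + r * (x ^+ q * r^-1 ^+ q).
Proof.
move=> x0 r0 q0; have [xr|rx] := leP x r.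
  by rewrite ler_wpDr// !mulr_ge0 ?exprn_ge0 ?invr_ge0 ?(ltW r0).
rewrite -exprMn ler_wpDl ?(ltW r0)//.
have xr : x = r * (x * r^-1) by field; rewrite gt_eqF.
rewrite [leLHS]xr ler_wpM2l ?(ltW r0)//.
by rewrite ler_eXnr// ler_pdivlMr// mul1r ltW.
Qed.

Lemma fourier_abs_le1 n B t x : fourier_abs n B t x <= 1 :> R.
Proof.
rewrite /fourier_abs -sqrtr1 ler_sqrt//.
rewrite /fourier_sqr; set N := (count _ _)%:R.
set c := cosum _ _ _ _; set s := sinsum _ _ _ _.
have [N0|N0] := eqVneq N 0; first by rewrite N0 invr0 !mulr0 expr0n addr0.
have Np : 0 < N by rewrite lt_neqAle eq_sym N0 ler0n.
pose r := Num.sqrt (c ^+ 2 + s ^+ 2).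
have r2 : c ^+ 2 + s ^+ 2 = r ^+ 2 by rewrite sqr_sqrtr// addr_ge0 ?sqr_ge0.
have r0 : 0 <= r := sqrtr_ge0 _.
have H : c ^+ 2 + s ^+ 2 <= N * r.
  have -> : c ^+ 2 + s ^+ 2 = \sum_(y <- words n | B y)
      (cos (freq n t * (hamming x y)%:R) * c + sin (freq n t * (hamming x y)%:R) * s).
    by rewrite big_split -!mulr_suml !expr2.
  rewrite /N -sum1_count natr_sum mulr_suml; apply: ler_sum => y _.
  by apply: dot_le_norms => //; rewrite cos2Dsin2 expr1n.
have rN : r <= N.
  move: H; rewrite r2 expr2; have [->|rn0] := eqVneq r 0; first by move=> _; exact: ltW.
  by rewrite ler_pM2r// lt_neqAle eq_sym rn0.
rewrite !expr_div_n -mulrDl r2 ler_pdivrMr ?exprn_gt0// mul1r.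
by rewrite lerXn2r ?nnegrE// ltW.
Qed.

(** The threshold for [fourier_abs] at frequency [t].  It is the simplest function
    with [decay^(-q) <= expR (gamma * n)] for the exponent [q] of the moment bound
    and with a sum over [t] of order [sqrt n]. *)
Definition decay n (c : R) t : R :=
  (1 + n%:R * (c * (1 - `|cos (freq n t)|)))^-1.

(** The hypothesis on the product of the sizes leaves room for two factors
    [expR (gamma * n)]: one for the loss [(1 + 8 eps)^n] in the moment bound, the
    other for dividing by the [q]-th power of the threshold. *)
Lemma sum_fourier_abs_le (gamma eps c : R) n (A B : pred (seq bool)) t :
  0 < eps -> eps <= 8^-1 -> 1 + 8 * eps <= expR gamma ->
  0 < c -> 64 * c <= gamma * eps ^+ 4 ->
  2 ^+ n * expR (2 * gamma * n%:R) <=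
    (count A (words n))%:R * (count B (words n))%:R ->
  \sum_(x <- words n | A x) fourier_abs n B t x <=
    2 * decay n c t * (count A (words n))%:R.
Proof.
move=> e0 e8 eg c0 ce; set a := (count A _)%:R; set b := (count B _)%:R => ab.
set kap := 1 - `|cos (freq n t)|.
have k0 : 0 <= kap by rewrite subr_ge0 cos_max.
have k1 : kap <= 1 by rewrite gerBl.
have a0 : 0 <= a := ler0n _ _.
have e4 : 0 < eps ^+ 4 by rewrite exprn_gt0.
have sumA (r : R) : \sum_(x <- words n | A x) r = r * a.
  by rewrite big_const_seq iter_addr_0 mulr_natr.
(* At the frequencies 0 and pi only the trivial bound holds. *)
have [kap0|kapn0] := eqVneq kap 0.
  rewrite /decay -/kap kap0 !mulr0 addr0 invr1 mulr1.
  apply: le_trans (ler_sum _ (fun x _ => fourier_abs_le1 _ _ _ x)) _.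
  by rewrite sumA ler_wpM2r// ler1n.
have kp : 0 < kap by rewrite lt_neqAle eq_sym kapn0.
(* The moment bound needs the exponent [4l] with [l >= L]. *)
pose L := 8 / (kap * eps ^+ 4).
pose l := (Num.truncn L).+1.
have ke : 0 < kap * eps ^+ 4 by rewrite mulr_gt0.
have L0 : 0 <= L by rewrite divr_ge0// ltW.
have /andP[l1 l2] := truncn_itv L0.
have Ll : 8 <= l%:R * (kap * eps ^+ 4) by rewrite -ler_pdivrMr// ltW.
have lL : l%:R * (kap * eps ^+ 4) <= 16.
  have ke1 : kap * eps ^+ 4 <= 1.
    by rewrite mulr_ile1 ?exprn_ile1 ?exprn_ge0 ?(ltW e0)//; lra.
  have : L * (kap * eps ^+ 4) = 8 by rewrite /L divfK// gt_eqF.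
  have := ler_wpM2r (ltW ke) l1; rewrite /l -natr1; lra.
have M : b * (\sum_(x <- words n) fourier_sqr (freq n t) n B x ^+ l.*2)
    <= (2 * (1 + 8 * eps)) ^+ n.
  by apply: fourier_moment_le => //; rewrite -subr_gt0.
pose r := decay n c t.
have nck0 : 0 <= n%:R * (c * kap) by rewrite !mulr_ge0// ltW.
have rV : r^-1 = 1 + n%:R * (c * kap) by rewrite invrK.
have r0 : 0 < r by rewrite invr_gt0 ltr_pwDl.
have rV0 : 0 <= r^-1 by rewrite rV addr_ge0.
pose q := l.*2.*2.
have q0 : (0 < q)%N by rewrite /q !double_gt0.
have phiq x : fourier_abs n B t x ^+ q = fourier_sqr (freq n t) n B x ^+ l.*2.
  by rewrite /q -muln2 mulnC exprM /fourier_abs sqr_sqrtr ?fourier_sqr_ge0.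
set S := \sum_(x <- words n) _ in M.
have SA : \sum_(x <- words n | A x) fourier_abs n B t x ^+ q <= S.
  rewrite big_mkcond /S; apply: ler_sum => x _; rewrite phiq.
  by case: (A x) => //; rewrite exprn_ge0 ?fourier_sqr_ge0.
have rq : r^-1 ^+ q <= expR (gamma * n%:R).
  have r1 : r^-1 <= expR (n%:R * (c * kap)) by rewrite rV expR_ge1Dx.
  apply: le_trans (lerXn2r q _ _ r1) _; rewrite ?nnegrE ?expR_ge0//.
  rewrite -expRM_natr ler_expR -mulrA [leRHS]mulrC ler_wpM2l//.
  rewrite -(ler_pM2r e4); apply: le_trans ce.
  rewrite /q -!mul2n !natrM.
  have := ler_wpM2l (ltW c0) lL; lra.
have Kn : (2 * (1 + 8 * eps)) ^+ n <= 2 ^+ n * expR (gamma * n%:R).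
  rewrite exprMn ler_wpM2l ?exprn_ge0// expRM_natr lerXn2r ?nnegrE ?expR_ge0//.
  lra.
have b0 : 0 < b.
  rewrite lt_neqAle ler0n andbT eq_sym; apply/eqP => b00; move: ab.
  by rewrite b00 mulr0 leNgt mulr_gt0 ?exprn_gt0 ?expR_gt0//.
have main : r^-1 ^+ q * S <= a.
  rewrite -(ler_pM2r b0); apply: le_trans ab.
  rewrite -(mulrA _ S b) (mulrC S).
  have -> : 2 ^+ n * expR (2 * gamma * n%:R) =
     expR (gamma * n%:R) * (2 ^+ n * expR (gamma * n%:R)).
    rewrite mulrCA -expRD; congr (_ * expR _); ring.
  apply: ler_pM => //.
  - by rewrite exprn_ge0.
  - rewrite mulr_ge0 ?(ltW b0)// sumr_ge0// => x _.
    by rewrite exprn_ge0 ?fourier_sqr_ge0.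
  - exact: le_trans M Kn.
apply: le_trans (ler_sum _ (fun x _ =>
  le_add_exprn_div (sqrtr_ge0 _ : 0 <= fourier_abs n B t x) r0 q0)) _.
rewrite big_split /= sumA -mulr_sumr -mulr_suml -/r.
have : r * (r^-1 ^+ q * S) <= r * a by rewrite ler_wpM2l// ltW.
have : r * ((\sum_(x <- words n | A x) fourier_abs n B t x ^+ q) * r^-1 ^+ q)
   <= r * (r^-1 ^+ q * S).
  rewrite ler_wpM2l ?(ltW r0)// mulrC ler_wpM2l//.
  by rewrite exprn_ge0.
lra.
Qed.

(** The minimum of the distances to the two zeros of [sin] is traded for a sum, so
    that the sum over [t] splits into two copies of the same series. *)
Lemma decay_le n (c : R) t : 0 < c -> (0 < n)%N -> (t <= n.+1)%N ->
  decay n c t <= (1 + c / 8 * t%:R ^+ 2 / n%:R)^-1 +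
                 (1 + c / 8 * (n.+1 - t)%:R ^+ 2 / n%:R)^-1.
Proof.
move=> c0 n0 tn.
have N0 : 0 < n%:R :> R by rewrite ltr0n.
have g0 (u : nat) : 0 < 1 + c / 8 * u%:R ^+ 2 / n%:R.
  by rewrite ltr_pwDl// !mulr_ge0 ?sqr_ge0 ?invr_ge0 ?(ltW c0).
have H : decay n c t <= (1 + c / 8 * (minn t (n.+1 - t))%:R ^+ 2 / n%:R)^-1.
  have K := @oneB_abs_cos_frac_ge R t n.+1 isT tn.
  rewrite -/(freq n t) in K.
  have k0 : 0 <= 1 - `|cos (freq n t)| by rewrite subr_ge0 cos_max.
  rewrite /decay lef_pV2 ?posrE// ?ltr_pwDl ?mulr_ge0 ?(ltW c0)//.
  rewrite lerD2l.
  have K2 := ler_wpM2l (mulr_ge0 (ler0n R n) (ltW c0)) K.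
  rewrite -[leRHS]mulrA in K2; apply: le_trans K2.
  set d := (minn _ _)%:R ^+ 2.
  have d0 : 0 <= d by apply: sqr_ge0.
  have -> : c / 8 * d / n%:R = c * d * (8 * n%:R)^-1.
    by field; rewrite gt_eqF.
  have -> : n%:R * c * (d / (2 * n.+1%:R ^+ 2)) =
     c * d * (n%:R / (2 * n.+1%:R ^+ 2)) by ring.
  rewrite ler_wpM2l ?mulr_ge0 ?(ltW c0)//.
  rewrite ler_pdivlMr ?mulr_gt0 ?exprn_gt0// mulrC ler_pdivrMr ?mulr_gt0//.
  have : 1 <= n%:R :> R by rewrite ler1n.
  rewrite -natr1; nra.
apply: le_trans H _; rewrite /minn; case: ifP => _.
  by rewrite lerDl invr_ge0 ltW.
by rewrite lerDr invr_ge0 ltW.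
Qed.

Lemma sum_decay_le n (c : R) : 0 < c -> c <= 1 -> (0 < n)%N ->
  \sum_(0 <= t < n.+1.*2) decay n c t <= 128 / c * Num.sqrt n%:R.
Proof.
move=> c0 c1 n0.
have decayD t : decay n c (t + n.+1) = decay n c t.
  rewrite /decay (_ : freq n (t + n.+1) = freq n t + pi).
    by rewrite cosDpi normrN.
  by rewrite /freq natrD; field; rewrite gt_eqF.
pose g j : R := (1 + c / 8 * j%:R ^+ 2 / n%:R)^-1.
have g0 j : 0 <= g j.
  by rewrite invr_ge0 addr_ge0// !mulr_ge0 ?sqr_ge0 ?invr_ge0 ?(ltW c0).
have G p : \sum_(0 <= j < p) g j <= 32 / c * Num.sqrt n%:R.
  have := @sum_inv1Dsqr_le R (c / 8) n p.
  have -> : 4 / (c / 8) = 32 / c by field; rewrite gt_eqF.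
  by apply => //; lra.
have half : \sum_(0 <= t < n.+1) decay n c t <= 64 / c * Num.sqrt n%:R.
  apply: le_trans (_ : \sum_(0 <= t < n.+1) (g t + g (n.+1 - t)%N) <= _).
    rewrite big_nat_cond [leRHS]big_nat_cond; apply: ler_sum => t.
    by rewrite andbT => /andP[_ /ltnW tn]; exact: decay_le.
  rewrite big_split /=.
  have := G n.+1.
  have : \sum_(0 <= t < n.+1) g (n.+1 - t)%N <= 32 / c * Num.sqrt n%:R.
    apply: le_trans (G n.+2); rewrite big_nat_rev /= [leRHS]big_nat_recl//=.
    rewrite (@eq_big_nat _ _ _ _ _ _ (g \o succn)); first by rewrite lerDr.
    by move=> i /andP[_ ilt] /=; congr g; lia.
  lra.
rewrite -addnn (@big_cat_nat _ _ _ n.+1)//= ?leq_addr//.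
rewrite -{2}[n.+1]add0n big_addn addnK.
under [X in _ + X]eq_bigr do rewrite decayD.
lra.
Qed.

End PointProb.

(** The constant depends on [gamma] only: first [eps] is chosen so that the moment
    bound loses at most [expR gamma] per coordinate, then [c]. *)
Lemma average_fourier_le (R : realType) (gamma : R) : 0 < gamma ->
  exists2 C : R, 0 < C & forall n (A B : pred (seq bool)), (0 < n)%N ->
    2 ^+ n * expR (2 * gamma * n%:R) <=
      (count A (words n))%:R * (count B (words n))%:R ->
    \sum_(x <- words n | A x)
       (n.+1.*2%:R^-1 * \sum_(0 <= t < n.+1.*2) fourier_abs R n B t x)
    <= C / Num.sqrt n%:R * (count A (words n))%:R.
Proof.
move=> g0.
have eg1 : 1 < expR gamma by rewrite expR_gt1.
pose eps := Num.min (8^-1) ((expR gamma - 1) / 8).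
have e0 : 0 < eps by rewrite /eps lt_min; apply/andP; split; lra.
have e8 : eps <= 8^-1 by rewrite /eps ge_min lexx.
have eg : 1 + 8 * eps <= expR gamma.
  have : eps <= (expR gamma - 1) / 8 by rewrite /eps ge_min lexx orbT.
  lra.
have e4 : 0 < eps ^+ 4 by rewrite exprn_gt0.
pose c := Num.min 1 (gamma * eps ^+ 4 / 64).
have c0 : 0 < c by rewrite /c lt_min ltr01 !mulr_gt0 ?invr_gt0.
have c1 : c <= 1 by rewrite /c ge_min lexx.
have ce : 64 * c <= gamma * eps ^+ 4.
  have : c <= gamma * eps ^+ 4 / 64 by rewrite /c ge_min lexx orbT.
  lra.
exists (128 / c) => [|n A B n0 AB]; first by rewrite divr_gt0.
have a0 : 0 <= (count A (words n))%:R :> R by [].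
rewrite -mulr_sumr exchange_big /= ler_pdivrMl ?ltr0n//.
apply: le_trans (ler_sum _ (fun t _ => sum_fourier_abs_le t e0 e8 eg c0 ce AB)) _.
rewrite -mulr_suml -mulr_sumr mulrA ler_wpM2r//.
have S := sum_decay_le c0 c1 n0.
set s := Num.sqrt _ in S *.
have s2 : s ^+ 2 = n%:R by rewrite sqr_sqrtr.
have s0 : 0 < s by rewrite sqrtr_gt0 ltr0n.
have -> : n.+1.*2%:R * (128 / c / s) = 2 * (128 / c * s) + 256 / c / s.
  rewrite -mul2n natrM -(natr1 n) -s2; field; rewrite !gt_eqF//.
by rewrite (le_trans (ler_wpM2l _ S))// lerDl !mulr_ge0 ?invr_ge0// ltW//.
Qed.

(** * From words to the cube *)

Section Encoding.
Variable n : nat.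
Implicit Types x y : cube n.

Definition encode x : seq bool := [seq ssval (x j) == 1 | j <- enum 'I_n].

Lemma encode_inj : injective encode.
Proof.
move=> x y /eq_in_map E; apply/ffunP => j; apply: val_inj.
have := E j (mem_enum _ _).
have := ssvalP (x j); have := ssvalP (y j); rewrite !inE /=.
by do 2![case/orP => /eqP->].
Qed.

Lemma inner_hamming x y :
  inner x y = n%:Z - (hamming (encode x) (encode y)).*2%:Z.
Proof.
rewrite /inner /encode -big_enum /=.
have -> : n%:Z = (size (enum 'I_n))%:Z by rewrite size_enum_ord.
elim: (enum 'I_n) => [|j s IH]; first by rewrite big_nil.
rewrite big_cons IH /=.
have := ssvalP (x j); have := ssvalP (y j); rewrite !inE /=.
by do 2![case/orP => /eqP->]; lia.
Qed.

Lemma perm_encode : perm_eq [seq encode x | x <- enum {: cube n}] (words n).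
Proof.
have U : uniq [seq encode x | x <- enum {: cube n}].
  by rewrite map_inj_uniq ?enum_uniq//; exact: encode_inj.
have sub : {subset [seq encode x | x <- enum {: cube n}] <= words n}.
  by move=> w /mapP[x _ ->]; rewrite mem_words size_map size_enum_ord.
have sz : (size (words n) <= size [seq encode x | x <- enum {: cube n}])%N.
  rewrite size_map -cardE card_ffun card_ord card_seq_sub//=.
  elim: n => //= m IH; rewrite size_cat !size_map expnS; lia.
have [_ E] := uniq_min_size U sub sz.
by rewrite uniq_perm// uniq_words.
Qed.

Lemma count_words_encode (P : pred (seq bool)) :
  count P (words n) = #|[set x | P (encode x)]|.
Proof.
rewrite -(permP perm_encode) count_map cardE -size_filter.
congr size; rewrite /(enum (mem [set _ | _])) enumT.
by apply: eq_filter => x; rewrite /= inE.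
Qed.

Lemma sum_words_encode (V : nmodType) (P : pred (seq bool)) (F : seq bool -> V) :
  \sum_(w <- words n | P w) F w = \sum_(x | P (encode x)) F (encode x).
Proof.
by rewrite -(perm_big _ perm_encode) big_map big_enum_cond.
Qed.

(** Membership in the image of [B], as [encode] has no inverse on words of the
    wrong length. *)
Definition code (B : {set cube n}) : pred (seq bool) :=
  [pred w | w \in [seq encode y | y in B]].

Lemma code_encode B y : code B (encode y) = (y \in B).
Proof. by rewrite [LHS]fintype.mem_image; last exact: encode_inj. Qed.

Lemma count_code B : count (code B) (words n) = #|B|.
Proof.
rewrite count_words_encode; congr #|pred_of_set _|.
by apply/setP => y; rewrite inE code_encode.
Qed.

Lemma max_inner_prob_le (R : realType) (B : {set cube n}) x :
  max_inner_prob R B x <=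
  n.+1.*2%:R^-1 * \sum_(0 <= t < n.+1.*2) fourier_abs R n (code B) t (encode x).
Proof.
have [[k <-] _] := max_inner_probP R B x.
rewrite /unif_prob.
have [E0|[y0]] := set_0Vmem [set y in B | inner x y == k].
  rewrite E0 cards0 mul0r mulr_ge0 ?invr_ge0// sumr_ge0// => t _.
  exact: sqrtr_ge0.
rewrite inE => /andP[_ /eqP ky0].
set h := hamming (encode x) (encode y0).
have hn : (h <= n)%N.
  by rewrite (leq_trans (hamming_le_size _ _))// size_map size_enum_ord.
apply: le_trans (point_prob_le R (code B) (encode x) hn).
rewrite count_code count_words_encode le_eqVlt; apply/orP; left; apply/eqP.
congr (_%:R / _); congr #|pred_of_set _|; apply/setP => y.
rewrite !inE /= code_encode; congr (_ && _).
rewrite -ky0 !inner_hamming -/h; apply/eqP/eqP; lia.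
Qed.

End Encoding.

(** * Anticoncentration in most directions *)

Theorem theorem1 (R : realType) (beta delta : R)
    (hbeta : 0 < beta) (hdelta : 0 < delta) :
  exists2 C : R, 0 < C &
    forall (n : nat) (B : {set cube n}),
      (0 < n)%N ->
      #|B|%:R = 2 `^ (beta * n%:R) :> R ->
      #|[set x : cube n |
          ~~ (max_inner_prob R B x <= C / Num.sqrt (n%:R))]|%:R
        <= 2 `^ (n%:R * (1 - beta + delta)) :> R.
Proof.
have ln2 : 0 < ln 2 :> R by rewrite ln_gt0// ltr1n.
have g0 : 0 < delta * ln 2 / 2 by rewrite !mulr_gt0// invr_gt0.
have [C C0 avg] := average_fourier_le g0.
exists C => // n B n0 hB.
set A := [set _ | _]; rewrite leNgt; apply/negP => bigA.
have a0 : 0 < #|A|%:R :> R by apply: le_lt_trans bigA; exact: powR_ge0.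
have AB : 2 ^+ n * expR (2 * (delta * ln 2 / 2) * n%:R) <=
    (count (code A) (words n))%:R * (count (code B) (words n))%:R :> R.
  have -> : 2 ^+ n * expR (2 * (delta * ln 2 / 2) * n%:R) =
      2 `^ (n%:R * (1 - beta + delta)) * #|B|%:R.
    rewrite hB -powRD ?pnatr_eq0 ?implybT// -powR_mulrn// /powR pnatr_eq0 /=.
    by rewrite -expRD; congr expR; field.
  by rewrite !count_code ler_wpM2r// ltW.
have := avg _ _ _ n0 AB; rewrite leNgt => /negP; apply.
rewrite count_code sum_words_encode (eq_bigl (mem A)); last by move=> x; exact: code_encode.
rewrite mulr_natr -sumr_const.
have [x0 x0A] : exists x, x \in A.
  by apply/set0Pn; rewrite -card_gt0 -(ltr0n R).
apply: (@lt_le_trans _ _ (\sum_(x in A) max_inner_prob R B x)); last first.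
  by apply: ler_sum => x _; exact: max_inner_prob_le.
apply: ltr_sum => [|x]; first by apply/hasP; exists x0; rewrite ?mem_index_enum.
by rewrite inE -ltNge.
Qed.
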